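(* For a prime $q\ge3$, let $S$ be chosen uniformly at random among all $\frac{q-1}{2}$-element subsets of $\mathbb{F}_q$. Then the probability that $$\mathrm{Aut}(G_S)=\{\,v\mapsto \lambda v+b:\ \lambda\in\mathbb{F}_q^*,\ b\in\mathbb{F}_q^2\,\}$$ tends to $1$ as $q\to\infty$ through the primes. Consequently, asymptotically almost surely $|\mathrm{Aut}(G_S)|=q^2(q-1)$.
   Context: The graph $G_S$ has vertex set $\mathbb{F}_q^2$, and $u=(u_1,u_2)$, $v=(v_1,v_2)$ are adjacent iff $u_1\neq v_1$ and $(v_2-u_2)(v_1-u_1)^{-1}\in S$. *)

(* Defs.v *)
From HB Require Import structures.
From mathcomp Require Import all_boot all_order all_algebra all_fingroup all_field.
Set Implicit Arguments. Unset Strict Implicit. Unset Printing Implicit Defensive.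
Import Order.TTheory GRing.Theory Num.Theory.
Local Open Scope ring_scope.

Definition vert (q : nat) : finType := ('F_q * 'F_q)%type.

Definition GS_adj (q : nat) (S : {set 'F_q}) (u v : vert q) : bool :=
  (u.1 != v.1) && ((v.2 - u.2) / (v.1 - u.1) \in S).

Definition autGS (q : nat) (S : {set 'F_q}) : {set {perm vert q}} :=
  [set s : {perm vert q} | [forall u, forall v,
      GS_adj S (s u) (s v) == GS_adj S u v]].

Definition affine_maps (q : nat) : {set {perm vert q}} :=
  [set s : {perm vert q} | [exists l : 'F_q, exists b : vert q,
      (l != 0) && [forall v : vert q,
         s v == (l * v.1 + b.1, l * v.2 + b.2)]]].

Definition half_subsets (q : nat) : {set {set 'F_q}} :=
  [set S : {set 'F_q} | #|S| == (q.-1)./2]%N.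

Definition prob_half (q : nat) (P : {set 'F_q} -> bool) : rat :=
  (#|[set S in half_subsets q | P S]|)%:R / (#|half_subsets q|)%:R.

(* Main.v *)
Require Import Defs.
From HB Require Import structures.
From mathcomp Require Import all_boot all_order all_algebra all_fingroup all_field.
From mathcomp Require Import ring zify.
Set Implicit Arguments. Unset Strict Implicit. Unset Printing Implicit Defensive.
Import Order.TTheory GRing.Theory Num.Theory.
Local Open Scope ring_scope.

(* An automorphism of [G_S] maps a line with slope in [S] to a clique of size
   [q], that is, to the graph of a function all of whose difference quotients lie
   in [S]. Since [|S| = (q - 1) / 2], Redei's theorem on directions over a prime
   field makes this clique a line again. So the automorphism permutes the
   parallel classes with slopes in [S], and as there are at least three of them
   it is affine. Its linear part acts on slopes by a Moebius transformation that
   preserves [S]. A non-scalar one has so few fixed points that it stabilizes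
   only [O(2^(q/2))] sets, and the union bound over the fewer than [q^4] such
   transformations is negligible against ['C(q, (q - 1) / 2)]. *)

(** * Redei's theorem over a prime field *)

(** Bounds the total degree of the mixed power sum used for Redei's theorem. It fails for odd [n],
    as [n = 3], [d = 2] shows. *)
Lemma divn_modn_half (n d : nat) :
  ~~ odd n -> (1 < d <= n)%N -> (n %/ d + n %% d <= n./2)%N.
Proof.
move=> n_even /andP[d_gt1 le_dn].
have /eqP En := divn_eq n d; have b_lt : (n %% d < d)%N by rewrite ltn_mod; lia.
have a_gt0 : (0 < n %/ d)%N by rewrite divn_gt0; lia.
move: (n %/ d)%N (n %% d)%N a_gt0 b_lt En => a b a_gt0 b_lt /eqP En.
have En2 : n = (n./2).*2 by rewrite -[LHS]odd_double_half (negbTE n_even).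
have [a1|a_gt1] := leqP a 1; first by (have a1' : a = 1%N by lia); subst a; lia.
have [d2|d_gt2] := leqP d 2; first by (have d2' : d = 2%N by lia); subst d; lia.
nia.
Qed.

Lemma prime_ndvd_fact (p n : nat) : prime p -> (n < p)%N -> ~~ (p %| n`!)%N.
Proof.
move=> p_pr; elim: n => [|n IHn] lt_np.
  by rewrite fact0 dvdn1; apply: contraTneq p_pr => ->.
rewrite factS Euclid_dvdM // negb_or IHn ?(ltnW lt_np) // andbT.
by rewrite gtnNdvd.
Qed.

Section PrimeField.
Variables (F : finFieldType) (p : nat).
Hypotheses (p_pr : prime p) (cardF : #|F| = p).

Lemma prime_field_pchar : p \in [pchar F].
Proof. by apply: (@card_finPcharP F p 1) => //; rewrite cardF expn1. Qed.

Lemma natr_neq0_lt (n : nat) : (0 < n < p)%N -> n%:R != 0 :> F.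
Proof.
move=> /andP[n_gt0 lt_np]; rewrite -(dvdn_pcharf prime_field_pchar).
by apply/negP => /dvdn_leq; lia.
Qed.

Lemma prime_field_natr (x : F) : exists n : nat, x = n%:R.
Proof.
pose h (i : 'I_p) : F := i%:R.
have h_inj : injective h.
  suff le_inj (i j : 'I_p) : (i <= j)%N -> h i = h j -> i = j.
    by move=> i j; case/orP: (leq_total i j) => [/le_inj //|/le_inj ji /esym/ji].
  move=> le_ij /eqP; rewrite eq_sym -subr_eq0 /h -natrB // => hij.
  have [lt_ij|] := boolP (i < j)%N; last by move=> ?; apply/val_inj => /=; lia.
  have := @natr_neq0_lt (j - i)%N; rewrite hij => /(_ _)/negP[] //.
  by have := ltn_ord j; lia.
have [|h' _ hK] := inj_card_bij h_inj; first by rewrite card_ord cardF.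
by exists (h' x); rewrite -[LHS]hK.
Qed.

Lemma additive_prime_field (h : F -> F) :
  {morph h : x y / x + y} -> forall x, h x = h 1 * x.
Proof.
move=> hD x; have [n ->] := prime_field_natr x.
have h0 : h 0 = 0 by apply: (addrI (h 0)); rewrite -hD !addr0.
elim: n => [|n IHn]; first by rewrite mulr0.
by rewrite -natr1 hD IHn mulrDr mulr1.
Qed.

(** Expanding [K y] in two ways shows that [G] and [H] differ by a constant, so [G x - G 0] is
    additive and hence linear. *)
Lemma pexider_prime_field (K G H : F -> F) :
  (forall x y, K (x + y) = G x + H y) ->
  forall x, G x = G 0 + (G 1 - G 0) * x.
Proof.
move=> KGH x.
have GH y : G y + H 0 = G 0 + H y by rewrite -!KGH addrC.
have hD : {morph (fun x => G x - G 0) : x y / x + y}.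
  move=> y z; have E : G (y + z) + H 0 = G y + H z by rewrite -!KGH addr0.
  have := GH z; move: E.
  move=> /(canRL (addrK _)) -> /(canRL (addrK _)) ->; ring.
by rewrite -[_ * x](additive_prime_field hD) addrC subrK.
Qed.

Lemma sum_expr_prime_field (k : nat) : (k < p.-1)%N -> \sum_(x : F) x ^+ k = 0.
Proof.
have p_gt1 := prime_gt1 p_pr.
case: k => [|k] lt_kp.
  (* Since [0 ^+ 0 = 1], the sum is [p] times one. *)
  under eq_bigr do rewrite expr0.
  by rewrite sumr_const cardF; apply: pcharf0 prime_field_pchar.
(* Otherwise [p - 1] elements would be roots of unity of a smaller order. Scaling by such an [a]
   permutes the terms but multiplies the sum by a factor other than 1. *)
have [a a_neq0 ak_neq1] : exists2 a : F, a != 0 & a ^+ k.+1 != 1.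
  apply/exists_inP; apply: contraTT lt_kp => /exists_inPn unity.
  pose rs := rem (0 : F) (enum F).
  have rs_uniq : uniq rs by rewrite rem_uniq ?enum_uniq.
  have <- : size rs = p.-1 by rewrite size_rem ?mem_enum // -cardE cardF.
  rewrite -leqNgt; apply: (@max_unity_roots F k.+1) => //.
  apply/allP => a; rewrite mem_rem_uniq ?enum_uniq // inE => /andP[a_neq0 _].
  by have := unity a; rewrite unfold_in negbK unity_rootE; apply.
have : \sum_(x : F) x ^+ k.+1 = \sum_(x : F) (a * x) ^+ k.+1.
  exact: (reindex_inj (mulfI a_neq0)).
move/eqP => E; apply/eqP; move: E.
under [X in _ == X]eq_bigr do rewrite exprMn.
rewrite -mulr_sumr -{1}[\sum_i _]mul1r -subr_eq0 -mulrBl mulf_eq0 subr_eq0.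
by rewrite eq_sym (negbTE ak_neq1).
Qed.

Lemma expf_pred_prime_field (x : F) : x ^+ p.-1 = (x != 0)%:R.
Proof.
have p_gt1 := prime_gt1 p_pr.
have [->|x_neq0] := eqVneq; first by rewrite expr0n; case: p p_gt1 => [|[]].
apply: (mulfI x_neq0); rewrite -exprS prednK ?(ltnW p_gt1) //.
by rewrite mulr1 -cardF expf_card.
Qed.

Lemma sum_expr_pred_prime_field : \sum_(x : F) x ^+ p.-1 = -1.
Proof.
under eq_bigr do rewrite expf_pred_prime_field.
rewrite (bigD1 0) //= eqxx add0r (eq_bigr (fun=> 1)) => [|x ->//].
apply/eqP; rewrite -subr_eq0 opprK.
rewrite sumr_const cardC1 cardF natr1 prednK ?prime_gt0 //.
by rewrite (pcharf0 prime_field_pchar).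
Qed.

(** Among the monomials of degree below [p], only that of degree [p - 1] has a nonzero power sum. *)
Lemma sum_horner_prime_field (g : {poly F}) :
  (size g <= p)%N -> \sum_(x : F) g.[x] = - g`_p.-1.
Proof.
move=> sz_g; have p_gt0 := prime_gt0 p_pr.
under eq_bigr do rewrite (horner_coef_wide _ sz_g).
rewrite exchange_big /=.
under eq_bigr do rewrite -mulr_sumr.
have lt_p : (p.-1 < p)%N by rewrite prednK.
rewrite (bigD1 (Ordinal lt_p)) //= sum_expr_pred_prime_field mulrN1.
rewrite big1 ?addr0 // => i i_neq; rewrite sum_expr_prime_field ?mulr0 //.
by have := ltn_ord i; move: i_neq; rewrite -val_eqE /=; lia.
Qed.

Lemma interpolation_prime_field (f : F -> F) :
  exists2 g : {poly F}, (size g <= p)%N & forall x, g.[x] = f x.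
Proof.
have p_gt0 := prime_gt0 p_pr.
(* By Fermat, [1 - (x - a) ^+ p.-1] is the indicator of [x = a]. *)
exists (\sum_(a : F) f a *: (1 - ('X - a%:P) ^+ p.-1)).
  apply: (big_ind (fun g : {poly F} => size g <= p)%N).
  - by rewrite size_poly0.
  - by move=> g h sg sh; rewrite (leq_trans (size_polyD _ _)) // geq_max sg.
  move=> a _; rewrite (leq_trans (size_scale_leq _ _)) //.
  rewrite (leq_trans (size_polyD _ _)) // geq_max size_poly1 p_gt0.
  by rewrite size_polyN size_exp_XsubC ltn_predL.
move=> x; rewrite horner_sum (bigD1 x) //= big1 => [|a a_neq].
  by rewrite !hornerE expf_pred_prime_field subrr eqxx subr0 mulr1.
rewrite !hornerE expf_pred_prime_field subr_eq0 eq_sym (negbTE a_neq) /=.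
by rewrite subrr mulr0.
Qed.

(* If [c] is not a direction of the graph of [f], then [f x - c x] permutes the
   field, so its power sums of order below [p - 1] vanish; as polynomials in
   [c] of degree less than the number of such [c] they vanish identically. *)
Lemma mixed_power_sum_eq0 (f : F -> F) (D : {set F}) (i j : nat) :
  {in D, forall c, injective (fun x => f x - c * x)} ->
  (i + j < #|D|)%N -> (i + j < p.-1)%N ->
  \sum_(x : F) x ^+ i * f x ^+ j = 0.
Proof.
move=> Dinj ltD ltp; set k := (i + j)%N in ltD ltp.
pose m l := \sum_(x : F) x ^+ l * f x ^+ (k - l).
pose P := \poly_(l < k.+1) ((-1) ^+ l * m l *+ 'C(k, l)).
have PE c : P.[c] = \sum_(x : F) (f x - c * x) ^+ k.
  rewrite horner_poly; under [RHS]eq_bigr do rewrite exprBn.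
  rewrite exchange_big /=; apply: eq_bigr => l _.
  rewrite mulrnAl sumrMnl; congr (_ *+ _).
  rewrite /m mulr_sumr mulr_suml; apply: eq_bigr => x _.
  by rewrite exprMn; ring.
have P0 : P = 0.
  apply: (@roots_geq_poly_eq0 _ _ (enum D)); rewrite ?enum_uniq //.
    apply/allP => c; rewrite mem_enum => cD; rewrite /root PE.
    apply/eqP/(etrans _ (sum_expr_prime_field ltp))/esym.
    exact: (reindex_inj (Dinj c cD)).
  by rewrite -cardE (leq_trans (size_poly _ _)).
(* This coefficient is the wanted sum up to sign and a binomial coefficient, which is prime to [p]
   because [k < p]. *)
have := coef_poly k.+1 (fun l => (-1) ^+ l * m l *+ 'C(k, l)) i.
rewrite -/P P0 coef0 ltnS leq_addr => /esym/eqP.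
rewrite -mulr_natr !mulf_eq0 signr_eq0 orFb => /orP[/eqP|].
  by rewrite /m addKn.
rewrite -(dvdn_pcharf prime_field_pchar) => dvd_bin.
have dvd_fact : (p %| k`!)%N.
  by rewrite -(bin_fact (leq_addr j i)) dvdn_mulr.
by move: dvd_fact; rewrite (negbTE (prime_ndvd_fact _ _)) //; lia.
Qed.

(** Let [g] interpolate [f] and have degree [d >= 2]. Dividing [p - 1] by [d] yields [a], [b] such
    that ['X^b * g ^+ a] has degree exactly [p - 1], so its values have a nonzero sum; yet [a + b]
    is small enough for this mixed power sum to vanish. *)
Lemma redei_prime_field (f : F -> F) (D : {set F}) :
  odd p -> (p.-1./2 < #|D|)%N ->
  {in D, forall c, injective (fun x => f x - c * x)} ->
  exists m b, forall x, f x = m * x + b.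
Proof.
move=> p_odd cardD Dinj; have p_gt1 := prime_gt1 p_pr.
have [g sz_g gE] := interpolation_prime_field f.
have [sz2|sz_gt2] := leqP (size g) 2.
  exists g`_1, g`_0 => x; rewrite -gE (horner_coef_wide _ sz2).
  by rewrite big_ord_recl big_ord1 /= expr0 expr1 mulr1 addrC.
pose d := (size g).-1; pose a := (p.-1 %/ d)%N; pose b := (p.-1 %% d)%N.
have ab_le : (a + b <= p.-1./2)%N.
  by apply: divn_modn_half; rewrite ?/d //; lia.
pose h := 'X^b * g ^+ a.
have g_neq0 : g != 0 by rewrite -size_poly_gt0; lia.
have sz_h : size h = p.
  rewrite /h size_monicM ?monicXn ?expf_neq0 // size_polyXn addSn /=.
  have ga_gt0 : (0 < size (g ^+ a))%N by rewrite size_poly_gt0 expf_neq0.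
  rewrite -(prednK ga_gt0) size_exp -/d addnS addnC mulnC -divn_eq.
  by rewrite prednK // ltnW.
have : \sum_(x : F) h.[x] = 0.
  under eq_bigr do rewrite hornerM hornerXn horner_exp gE.
  by apply: (mixed_power_sum_eq0 Dinj); lia.
rewrite sum_horner_prime_field ?sz_h // -[in p.-1]sz_h => /eqP.
rewrite oppr_eq0 -/(lead_coef h) lead_coef_eq0 => /eqP h0.
by move: sz_h; rewrite h0 size_poly0; lia.
Qed.
End PrimeField.

(** * Cycles and stable sets of a permutation *)

(** A cycle has at least two points unless it is a fixed point, which the right-hand side counts
    twice. *)
Lemma double_card_porbits (T : finType) (s : {perm T}) :
  (2 * #|porbits s| <= #|T| + #|[set x | s x == x]|)%N.
Proof.
rewrite -[#|T|]sum1_card -[#|[set _ | _]|]sum1_card.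
rewrite (partition_big (porbit s) (mem (porbits s))) => [|x _]; last first.
  exact: imset_f.
rewrite [X in (_ + X)%N](partition_big (porbit s) (mem (porbits s))) => [|x _];
  last exact: imset_f.
rewrite -big_split /= mulnC -sum_nat_const; apply: leq_sum => _ /imsetP[y _ ->].
rewrite !sum1dep_card.
have [sy|sy] := boolP (s y == y).
  have -> : 2%N = (#|[set y]| + #|[set y]|)%N by rewrite cards1.
  by apply: leq_add; apply/subset_leq_card/subsetP => x /set1P ->;
    rewrite !inE ?sy eqxx.
have -> : 2%N = #|[set y; s y]| by rewrite cards2 eq_sym sy.
rewrite (leq_trans _ (leq_addr _ _)) //; apply/subset_leq_card/subsetP => x.
by case/set2P => ->; rewrite !inE // eq_porbit_mem (mem_porbit s 1).
Qed.

(** A stable set is a union of cycles, so the cycles that it meets determine it. *)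
Lemma card_stable_sets (T : finType) (s : {perm T}) :
  (#|[set A : {set T} | s @: A \subset A]| <= 2 ^ #|porbits s|)%N.
Proof.
rewrite -card_powerset.
rewrite -(@card_in_imset _ _ (fun A : {set T} => porbit s @: A)).
  apply/subset_leq_card/subsetP => _ /imsetP[A _ ->]; rewrite inE.
  by apply/subsetP => _ /imsetP[x _ ->]; apply: imset_f.
suff sub (A B : {set T}) : s @: A \subset A -> s @: B \subset B ->
    porbit s @: A = porbit s @: B -> A \subset B.
  move=> A B; rewrite !inE => sA sB AB; apply/eqP.
  by rewrite eqEsubset (sub _ _ sA sB AB) (sub _ _ sB sA (esym AB)).
move=> sA sB AB; apply/subsetP => x xA.
have : porbit s x \in porbit s @: B by rewrite -AB imset_f.
case/imsetP => y yB /eqP; rewrite eq_porbit_mem => /porbitP[i ->].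
elim: i => [|i IHi]; first by rewrite perm1.
by rewrite expgSr permM; apply: (subsetP sB); rewrite imset_f.
Qed.

(** * Moebius transformations acting on slopes *)

Section Moebius.
Variable F : finFieldType.
Implicit Types a b c d m : F.

(* The linear map [(x, y) |-> (a x + b y, c x + d y)] acts on slopes by a Moebius
   transformation of the projective line; removing infinity from its cycle
   makes it a permutation of [F]. *)
Definition moebius a b c d m : F :=
  if a + b * m == 0 then d / b else (c + d * m) / (a + b * m).

Lemma moebius_pole a b c d m :
  a * d - b * c != 0 -> a + b * m = 0 -> b != 0.
Proof.
move=> det_neq0 E; apply: contraNneq det_neq0 => b0; move: E.
by rewrite b0 !mul0r addr0 => ->; rewrite mul0r subr0.
Qed.

Lemma moebius_inj a b c d : a * d - b * c != 0 -> injective (moebius a b c d).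
Proof.
move=> det_neq0.
have b_neq0 m := @moebius_pole a b c d m det_neq0.
(* The value [d / b] at the pole is the image of infinity; attaining it elsewhere would force the
   determinant to vanish. *)
have asym m n : a + b * m = 0 -> a + b * n != 0 ->
    d / b = (c + d * n) / (a + b * n) -> False.
  move=> Em n_neq0 /eqP; rewrite eqr_div ?(b_neq0 m) // => /eqP E.
  case/eqP: det_neq0; transitivity (d * (a + b * n) - (c + d * n) * b); first ring.
  by rewrite E subrr.
move=> m n; rewrite /moebius; case: eqP => [Em|/eqP m_neq0];
  case: eqP => [En|/eqP n_neq0].
- move=> _; apply: (mulfI (b_neq0 m Em)); apply: (addrI a).
  by rewrite Em En.
- by move=> /(asym _ _ Em n_neq0).
- by move=> /esym/(asym _ _ En m_neq0).
move=> /eqP; rewrite eqr_div // => /eqP E.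
apply: (mulfI det_neq0); apply/eqP; rewrite -subr_eq0; apply/eqP.
transitivity ((c + d * m) * (a + b * n) - (c + d * n) * (a + b * m)); first ring.
by rewrite E subrr.
Qed.

(** Away from the pole, fixed points are roots of [b m^2 + (a - d) m - c], which is nonzero for a
    nonscalar matrix; the pole adds at most one. *)
Lemma card_fix_moebius a b c d :
  a * d - b * c != 0 -> ~~ [&& b == 0, c == 0 & a == d] ->
  (#|[set m | moebius a b c d m == m]| <= 3)%N.
Proof.
move=> det_neq0 nonscalar; pose P := Poly [:: - c; a - d; b].
have P_neq0 : P != 0.
  apply: contraNneq nonscalar => P0.
  have coefP i : [:: - c; a - d; b]`_i = 0 by rewrite -coef_Poly -/P P0 coef0.
  have /= /eqP := coefP 0%N; have /= /eqP := coefP 1%N; have /= /eqP := coefP 2%N.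
  by rewrite oppr_eq0 subr_eq0 => -> -> ->.
pose A := [set m | root P m].
have cardA : (#|A| <= 2)%N.
  rewrite cardE -ltnS (leq_trans (max_poly_roots P_neq0 _ (enum_uniq _))) //.
    by apply/allP => m; rewrite mem_enum inE.
  exact: size_Poly.
have sub : [set m | moebius a b c d m == m] \subset (- a / b) |: A.
  apply/subsetP => m; rewrite !inE /moebius.
  have [Em|m_neq0 /eqP E] := eqVneq (a + b * m) 0.
    move=> _; apply/orP; left.
    have b_neq0 := moebius_pole det_neq0 Em; apply/eqP/(mulIf b_neq0).
    by rewrite divfK // mulrC; apply: (addrI a); rewrite Em subrr.
  apply/orP; right; rewrite /root horner_Poly /=; apply/eqP.
  transitivity (m * (a + b * m) - (c + d * m)); first ring.
  by rewrite -{1}E divfK // subrr.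
rewrite (leq_trans (subset_leq_card sub)) // cardsU1.
exact: (leq_add (leq_b1 _) cardA).
Qed.

Lemma card_moebius_stable a b c d :
  a * d - b * c != 0 -> ~~ [&& b == 0, c == 0 & a == d] ->
  (#|[set A : {set F} | moebius a b c d @: A \subset A]| <= 2 ^ (#|F| + 3)./2)%N.
Proof.
move=> det_neq0 nonscalar; pose s := perm (moebius_inj det_neq0).
have sE (A : {set F}) : moebius a b c d @: A = s @: A.
  by apply: eq_imset => x; rewrite permE.
have -> : [set A : {set F} | moebius a b c d @: A \subset A]
        = [set A : {set F} | s @: A \subset A].
  by apply/setP => A; rewrite !inE sE.
rewrite (leq_trans (card_stable_sets s)) // leq_exp2l //.
rewrite -[#|porbits s|]doubleK half_leq // -mul2n.
apply: leq_trans (double_card_porbits s) _.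
have -> : [set x | s x == x] = [set m | moebius a b c d m == m].
  by apply/setP => x; rewrite !inE permE.
by rewrite leq_add2l card_fix_moebius.
Qed.
End Moebius.

(** * Injective endomorphisms of the slope graph are affine *)

Section SlopeGraph.
Variables (F : finFieldType) (p : nat).
Hypotheses (p_pr : prime p) (cardF : #|F| = p).
Implicit Types (S : {set F}) (s : F * F -> F * F) (u v w : F * F).

Definition slope_adj S u v : bool :=
  (u.1 != v.1) && ((v.2 - u.2) / (v.1 - u.1) \in S).

(** Lines of slope [m] go into lines of slope [m']; without division, coinciding points need no
    separate case. *)
Definition maps_slope s (m m' : F) : Prop := forall u v,
  v.2 - u.2 = m * (v.1 - u.1) -> (s v).2 - (s u).2 = m' * ((s v).1 - (s u).1).

Lemma slope_adj_line S m b x y : m \in S -> x != y ->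
  slope_adj S (x, m * x + b) (y, m * y + b).
Proof.
move=> mS xy; rewrite /slope_adj /= xy /=.
suff -> : (m * y + b - (m * x + b)) / (y - x) = m by [].
by apply: canLR (mulfK _) _; [rewrite subr_eq0 eq_sym | ring].
Qed.

Lemma hom_line S s m b :
  odd p -> #|S| = p.-1./2 -> {homo s : u v / slope_adj S u v} -> m \in S ->
  exists m' b', (forall x, (s (x, m * x + b)).2 = m' * (s (x, m * x + b)).1 + b')
    /\ (forall t, exists x, (s (x, m * x + b)).1 = t).
Proof.
move=> p_odd cardS s_hom mS; pose P x := s (x, m * x + b).
have P_adj x y : x != y -> slope_adj S (P x) (P y).
  by move=> xy; apply/s_hom/slope_adj_line.
have h_inj : injective (fun x => (P x).1).
  move=> x y Exy; apply/eqP; apply: contraT => /P_adj/andP[].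
  by rewrite Exy eqxx.
pose h' := invF h_inj; have h'K t : (P (h' t)).1 = t := f_invF h_inj t.
(* The image clique is the graph of a function of the abscissa. Slopes outside [S] are not
   directions of it, and there are [(p + 1) / 2] of them, just enough for Redei. *)
have [| c cS t t' /eqP E | m' [b' fE]] :=
    @redei_prime_field F p p_pr cardF (fun t => (P (h' t)).2) (~: S) p_odd.
- by rewrite cardsCs setCK cardS cardF; have := prime_gt1 p_pr; lia.
- apply/eqP; apply: contraT => tt'.
  have /P_adj : h' t != h' t'.
    by apply: contraNneq tt' => Eh; rewrite -(h'K t) Eh h'K.
  rewrite /slope_adj !h'K => /andP[_]; apply: contraTT => _.
  suff -> : ((P (h' t')).2 - (P (h' t)).2) / (t' - t) = c by rewrite inE in cS.
  apply: canLR (mulfK _) _; first by rewrite subr_eq0 eq_sym.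
  apply/eqP; rewrite -subr_eq0; move: E; rewrite eq_sym -subr_eq0.
  by move=> /eqP E; apply/eqP; rewrite -[RHS]E; ring.
exists m', b'; split => [x|t]; last by exists (h' t); apply: h'K.
rewrite -fE -/(P x); congr (P _).2; apply/esym.
exact: invF_f.
Qed.

(** The slope of the image could depend on the intercept [b]. Image lines of different slopes would
    meet, whereas the original parallels are disjoint and [s] is injective. *)
Lemma hom_maps_slope S s m : injective s ->
  odd p -> #|S| = p.-1./2 -> {homo s : u v / slope_adj S u v} -> m \in S ->
  exists2 m', m' \in S & maps_slope s m m'.
Proof.
move=> s_inj p_odd cardS s_hom mS.
have line b := hom_line b p_odd cardS s_hom mS.
have [m' [b' [lineE line_surj]]] := line 0.
exists m'.
  have /s_hom/andP[] := slope_adj_line 0 mS (oner_neq0 F).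
  rewrite !lineE; set t := (s _).1; set t' := (s _).1 => tt'.
  suff -> : (m' * t' + b' - (m' * t + b')) / (t' - t) = m' by [].
  by apply: canLR (mulfK _) _; [rewrite subr_eq0 eq_sym | ring].
move=> [x y] [x' y'] /= Euv; pose b := y - m * x.
have -> : y = m * x + b by rewrite /b; ring.
have -> : y' = m * x' + b.
  by rewrite -[LHS](subrK y) Euv /b; ring.
have [m1 [b1 [lineE1 line_surj1]]] := line b.
suff <- : m1 = m' by rewrite !lineE1; ring.
have [b0|b_neq0] := eqVneq b 0.
  have [x0 Ex0] := line_surj1 0; have [x1 Ex1] := line_surj1 1.
  have := lineE1 x1; have := lineE1 x0; rewrite b0 !lineE -b0 Ex0 Ex1.
  by rewrite !mulr0 !add0r !mulr1 => -> /addIr.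
apply/eqP; apply: contraNT b_neq0; rewrite -subr_eq0 => m_neq.
(* The abscissa where the two image lines meet. *)
pose t := (b' - b1) / (m1 - m').
have [x1 Ex1] := line_surj1 t; have [x0 Ex0] := line_surj t.
have : s (x1, m * x1 + b) = s (x0, m * x0 + 0).
  rewrite [LHS]surjective_pairing [RHS]surjective_pairing lineE lineE1 Ex0 Ex1.
  congr (_, _); apply/eqP; rewrite -subr_eq0; apply/eqP.
  transitivity (t * (m1 - m') - (b' - b1)); first by ring.
  by rewrite /t divfK // subrr.
by case/s_inj => -> /addrI ->.
Qed.

(** If [m1 != m2], any [u] and [v] are joined through a point [w] by steps of slopes [m1] and [m2],
    so all images would lie on one line of slope [m']. The points [(0, 0)] and [(0, 1)] do not. *)
Lemma maps_slope_inj s m1 m2 m' : (forall w, exists u, s u = w) ->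
  maps_slope s m1 m' -> maps_slope s m2 m' -> m1 = m2.
Proof.
move=> s_surj s1 s2; apply/eqP; apply: contraT; rewrite -subr_eq0 => m_neq.
have [u Eu] := s_surj (0, 0); have [v Ev] := s_surj (0, 1).
pose x := (v.2 - u.2 + m1 * u.1 - m2 * v.1) / (m1 - m2).
pose w := (x, u.2 + m1 * (x - u.1)).
have Ex : x * (m1 - m2) = v.2 - u.2 + m1 * u.1 - m2 * v.1 by rewrite divfK.
have /s1 : w.2 - u.2 = m1 * (w.1 - u.1) by rewrite /=; ring.
have /s2 : v.2 - w.2 = m2 * (v.1 - w.1).
  apply/eqP; rewrite -subr_eq0 /=; apply/eqP.
  transitivity (v.2 - u.2 + m1 * u.1 - m2 * v.1 - x * (m1 - m2)); first by ring.
  by rewrite Ex subrr.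
rewrite Eu Ev /= !subr0 sub0r => Ew2 Ew1; have := oner_neq0 F.
have -> : 1 = (1 - (s w).2) + (s w).2 :> F by ring.
by rewrite Ew2 Ew1 mulrN addNr eqxx.
Qed.

Lemma maps_slope_level s m m' : maps_slope s m m' -> forall v,
  (s v).2 - m' * (s v).1 =
  (s (0, v.2 - m * v.1)).2 - m' * (s (0, v.2 - m * v.1)).1.
Proof.
move=> s_m v; apply/eqP; rewrite -subr_eq0; apply/eqP.
set w := s (0, _).
have E : (s v).2 - w.2 = m' * ((s v).1 - w.1) by apply: s_m; rewrite /=; ring.
transitivity ((s v).2 - w.2 - m' * ((s v).1 - w.1)); first by ring.
by rewrite E subrr.
Qed.

(* The level functions [y - m x] of three slopes satisfy a linear relation, which
   makes the induced maps on levels solutions of Pexider's equation. *)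
Lemma three_slopes_affine s m1 m2 m3 n1 n2 n3 :
  [/\ m1 != m2, m2 != m3 & m3 != m1] -> [/\ n1 != n2, n2 != n3 & n3 != n1] ->
  maps_slope s m1 n1 -> maps_slope s m2 n2 -> maps_slope s m3 n3 ->
  exists a b c d e f, forall v,
    s v = (a * v.1 + b * v.2 + e, c * v.1 + d * v.2 + f).
Proof.
have neq_sub (x y : F) : x != y -> x - y != 0 by rewrite subr_eq0.
case=> /neq_sub m12 /neq_sub m23 /neq_sub m31.
case=> /neq_sub n12 /neq_sub n23 /neq_sub n31.
move=> /maps_slope_level s1 /maps_slope_level s2 /maps_slope_level s3.
pose g n X := (s (0, X)).2 - n * (s (0, X)).1.
(* With [L_i = y - m_i x], the relation is [(m2 - m3) L_1 + (m3 - m1) L_2 + (m1 - m2) L_3 = 0]; the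
   image levels satisfy the same one with [n_i]. *)
have pex x y : - (n1 - n2) * g n3 (- (x + y) / (m1 - m2)) =
    (n2 - n3) * g n1 (x / (m2 - m3)) + (n3 - n1) * g n2 (y / (m3 - m1)).
  pose x' := x / (m2 - m3); pose y' := y / (m3 - m1).
  have Ex : x = x' * (m2 - m3) by rewrite divfK.
  have Ey : y = y' * (m3 - m1) by rewrite divfK.
  (* The point whose levels for [m1] and [m2] are [x'] and [y']. *)
  pose v := ((y' - x') / (m1 - m2), x' + m1 * ((y' - x') / (m1 - m2))).
  have E1 : v.2 - m1 * v.1 = x' by rewrite /=; ring.
  have E2 : v.2 - m2 * v.1 = y' by rewrite /=; field.
  have E3 : v.2 - m3 * v.1 = - (x + y) / (m1 - m2).
    by rewrite Ex Ey /=; field.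
  have := s1 v; have := s2 v; have := s3 v; rewrite E1 E2 E3.
  by rewrite -/(g n1 x') -/(g n2 y') -/(g n3 _) => <- <- <-; ring.
have aff1 := pexider_prime_field p_pr cardF
  (K := fun z => - (n1 - n2) * g n3 (- z / (m1 - m2)))
  (G := fun x => (n2 - n3) * g n1 (x / (m2 - m3)))
  (H := fun y => (n3 - n1) * g n2 (y / (m3 - m1))) pex.
(* [pexider_prime_field] describes the first summand only, so the summands are exchanged. *)
have aff2 := pexider_prime_field p_pr cardF
  (K := fun z => - (n1 - n2) * g n3 (- z / (m1 - m2)))
  (G := fun y => (n3 - n1) * g n2 (y / (m3 - m1)))
  (H := fun x => (n2 - n3) * g n1 (x / (m2 - m3)))
  (fun x y => etrans
    (congr1 (fun z => - (n1 - n2) * g n3 (- z / (m1 - m2))) (addrC x y))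
    (etrans (pex y x) (addrC _ _))).
have affg n m N : N != 0 -> m != 0 ->
    (forall x, N * g n (x / m) =
       N * g n (0 / m) + (N * g n (1 / m) - N * g n (0 / m)) * x) ->
  forall X, g n X = g n 0 + (g n (1 / m) - g n 0) * m * X.
  move=> N0 m0 E X; apply: (mulfI N0).
  by have := E (X * m); rewrite mulfK // mul0r => ->; ring.
have {}aff1 := affg n1 _ _ n23 m23 aff1; have {}aff2 := affg n2 _ _ n31 m31 aff2.
set A1 := g n1 0 in aff1; set B1 := (_ * _) in aff1.
set A2 := g n2 0 in aff2; set B2 := (_ * _) in aff2.
(* Two affine level maps form a linear system for the coordinates of [s v], solvable since
   [n1 != n2]. *)
pose a := (B1 * m1 - B2 * m2) / (n1 - n2); pose b := (B2 - B1) / (n1 - n2).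
pose e := (A2 - A1) / (n1 - n2).
exists a, b, (n1 * a - B1 * m1), (n1 * b + B1), e, (n1 * e + A1) => v.
have := s1 v; have := s2 v; rewrite -/(g n1 _) -/(g n2 _) aff1 aff2.
move=> /(canRL (subrK _)) E2 /(canRL (subrK _)) E1.
have Ev1 : (s v).1 = a * v.1 + b * v.2 + e.
  apply: (mulIf n12); apply/eqP; rewrite -subr_eq0; apply/eqP.
  move: E1; rewrite E2 => /eqP; rewrite -subr_eq0 => /eqP E.
  transitivity (- (0 : F)); last by rewrite oppr0.
  by rewrite -E /a /b /e; field.
rewrite [s v]surjective_pairing E1 Ev1; congr (_, _); ring.
Qed.

Lemma affine_det_neq0 s a b c d e f : injective s ->
  (forall v, s v = (a * v.1 + b * v.2 + e, c * v.1 + d * v.2 + f)) ->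
  a * d - b * c != 0.
Proof.
move=> s_inj sE; apply: contraT; rewrite negbK => /eqP det0.
have ker x y : a * x + b * y = 0 -> c * x + d * y = 0 -> x = 0 /\ y = 0.
  move=> E1 E2; suff [-> ->] : (x, y) = (0, 0) by [].
  apply: s_inj; rewrite !sE /=; rewrite E1 E2; congr (_, _); ring.
(* A singular matrix kills [(d, -c)] and [(-b, a)]; injectivity then makes all entries zero, so it
   also kills [(1, 0)]. *)
have [|| d0 /eqP] := ker d (- c); [by rewrite -det0; ring | by ring |].
rewrite oppr_eq0 => /eqP c0.
have [|| /eqP] := ker (- b) a; [by ring | by rewrite -det0; ring |].
rewrite oppr_eq0 => /eqP b0 a0.
have [||/eqP] := ker 1 0; rewrite ?a0 ?b0 ?c0 ?d0 ?mul0r ?addr0 //.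
by rewrite oner_eq0.
Qed.

Lemma hom_affine S s : injective s -> odd p -> (2 < p.-1./2)%N ->
  #|S| = p.-1./2 -> {homo s : u v / slope_adj S u v} ->
  exists a b c d e f,
    [/\ forall v, s v = (a * v.1 + b * v.2 + e, c * v.1 + d * v.2 + f),
        a * d - b * c != 0 & moebius a b c d @: S \subset S].
Proof.
move=> s_inj p_odd p_gt cardS s_hom.
have s_surj w : exists u, s u = w.
  by have [s' _ s'K] := injF_bij s_inj; exists (s' w).
have : (2 < #|S|)%N by rewrite cardS.
case/card_gt2P => m1 [m2 [m3 [[m1S m2S m3S] [m12 m23 m31]]]].
have slope m := @hom_maps_slope S s m s_inj p_odd cardS s_hom.
have [n1 _ s1] := slope _ m1S; have [n2 _ s2] := slope _ m2S.
have [n3 _ s3] := slope _ m3S.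
have neq m m' n n' : m != m' -> maps_slope s m n -> maps_slope s m' n' -> n != n'.
  by move=> mm' sm sm'; apply: contraNneq mm' => nn'; rewrite nn' in sm;
    apply/eqP/(maps_slope_inj s_surj sm sm').
have [||a [b [c [d [e [f sE]]]]]] := three_slopes_affine _ _ s1 s2 s3.
- by split.
- by split; [apply: neq m12 s1 s2 | apply: neq m23 s2 s3 | apply: neq m31 s3 s1].
exists a, b, c, d, e, f; split => //; first exact: affine_det_neq0 s_inj sE.
apply/subsetP => _ /imsetP[m mS ->].
have z1 : 0 != 1 :> F by rewrite eq_sym oner_neq0.
(* The images of [(0, 0)] and [(1, m)] are adjacent: their abscissas differ, so [m] is not the pole,
   and their slope is the Moebius image of [m]. *)
have /s_hom/andP[] := slope_adj_line 0 mS z1.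
rewrite !sE /= -subr_eq0 => den_neq0.
have ne : a + b * m != 0.
  apply: contraNneq den_neq0 => E; apply/eqP/oppr_inj.
  by rewrite oppr0 -[RHS]E; ring.
rewrite /moebius (negbTE ne); congr (_ / _ \in S); ring.
Qed.
End SlopeGraph.

(** * Estimates for the union bound *)

Lemma leq_card_bigcup (T I : finType) (P : pred I) (A : I -> {set T}) (n : nat) :
  (forall i, P i -> #|A i| <= n)%N -> (#|\bigcup_(i | P i) A i| <= #|I| * n)%N.
Proof.
move=> leA; apply: (@leq_trans (\sum_(i | P i) n)); last first.
  by rewrite sum_nat_const leq_mul2r max_card orbT.
elim/big_rec2: _ => [|i m B Pi leB]; first by rewrite cards0.
by rewrite (leq_trans (leq_card_setU _ _)) // leq_add ?leA.
Qed.

(** Induction through the ratio [(k + 2) C(2k+3, k+1) = 2 (2k + 3) C(2k+1, k)]. *)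
Lemma leq_exp4_central_bin (k : nat) : (4 ^ k <= k.+1 * 'C(k.*2.+1, k))%N.
Proof.
elim: k => [|k IHk]; first by rewrite bin0.
have E1 := mul_bin_diag k.*2.+3 k; have E2 := mul_bin_down k.*2.+2 k.
rewrite /= in E1 E2; rewrite doubleS.
have Ek : (k.*2.+2 - k = k.+2)%N by lia.
rewrite Ek in E2.
set c := 'C(_, _) in IHk *; rewrite -/c in E2.
set x := 'C(_, _) in E2; rewrite -/x in E1.
set y := 'C(_, _) in E1; rewrite -/y.
have E3 : (k.+1 * (k.+2 * y) = k.+1 * (k.*2.+3 * c.*2))%N.
  rewrite mulnCA -E1 mulnCA -E2; nia.
have /eqP : (k.+2 * y == k.*2.+3 * c.*2)%N by rewrite -(eqn_pmul2l (ltn0Sn k)) E3.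
by move=> ->; rewrite expnS; nia.
Qed.

Lemma leq_expn6_exp2 (k : nat) : (32 <= k)%N -> (k ^ 6 <= 2 ^ k)%N.
Proof.
elim: k => // k IHk; rewrite leq_eqVlt => /predU1P[<-|le_k].
  by rewrite -[32%N]/(2 ^ 5)%N -expnM leq_exp2l.
(* Cubing bounds the growth factor of [k ^ 6] by 125/64, which is below 2. *)
have sq : (4 * k.+1 ^ 2 <= 5 * k ^ 2)%N by nia.
have cube : ((4 * k.+1 ^ 2) ^ 3 <= (5 * k ^ 2) ^ 3)%N by rewrite leq_exp2r.
rewrite (expnMn 4) (expnMn 5) -!expnM in cube.
have {}IHk := IHk le_k.
rewrite [(2 ^ _)%N]expnS -(@leq_pmul2l 64) //.
rewrite -[(4 ^ 3)%N]/64%N -[(5 ^ 3)%N]/125%N -[(2 * 3)%N]/6%N in cube.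
move: cube IHk; set a := (k.+1 ^ _)%N; set b := (k ^ _)%N; set c := (2 ^ k)%N.
lia.
Qed.

(** Here [2k + 1] stands for [q]. The constant [648 = 4 * 2 * 3^4] comes from [2^(k+2) = 4 * 2^k],
    [k + 1 <= 2k] and [2k + 1 <= 3k]; what remains is [648 M k^5 <= k^6 <= 2^k]. *)
Lemma union_bound_le_central_bin (M k : nat) : (32 <= k)%N -> (648 * M <= k)%N ->
  (M * (k.*2.+1 ^ 4 * 2 ^ k.+2) <= 'C(k.*2.+1, k))%N.
Proof.
move=> k_ge leM; rewrite -(leq_pmul2l (ltn0Sn k)).
apply: leq_trans (leq_exp4_central_bin k).
have -> : (4 ^ k = 2 ^ k * 2 ^ k)%N by rewrite -expnMn.
have -> : (k.+1 * (M * (k.*2.+1 ^ 4 * 2 ^ k.+2)) =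
           (4 * k.+1 * M * k.*2.+1 ^ 4) * 2 ^ k)%N by rewrite !expnS; ring.
rewrite leq_mul2r (leq_trans _ (leq_expn6_exp2 k_ge)) ?orbT //.
have le3 : (k.*2.+1 ^ 4 <= (3 * k) ^ 4)%N by rewrite leq_exp2r //; lia.
apply: (@leq_trans (4 * (2 * k) * M * (3 * k) ^ 4)).
  by rewrite leq_mul // leq_mul // leq_mul //; lia.
have -> : (4 * (2 * k) * M * (3 * k) ^ 4 = 648 * M * k ^ 5)%N.
  by rewrite expnMn -[(3 ^ 4)%N]/81%N [(k ^ 5)%N]expnS; ring.
by rewrite expnS leq_mul2r leM orbT.
Qed.

(** * Automorphisms of [G_S] and exceptional sets *)

Section GS.
Variable q : nat.
Hypothesis q_pr : prime q.
Implicit Types S : {set 'F_q}.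

Lemma affine_maps_autGS S : affine_maps q \subset autGS S.
Proof.
apply/subsetP => s; rewrite !inE => /existsP[l /existsP[b /andP[l_neq0 /forallP sE]]].
apply/forallP => u; apply/forallP => v.
rewrite (eqP (sE u)) (eqP (sE v)) /GS_adj /=; apply/eqP; congr (_ && _).
  by rewrite (inj_eq (addIr _)) (inj_eq (mulfI l_neq0)).
have sub x y c : l * x + c - (l * y + c) = l * (x - y) by ring.
by rewrite !sub -mulf_div divff // mul1r.
Qed.

Lemma card_affine_maps : #|affine_maps q| = (q ^ 2 * (q - 1))%N.
Proof.
(* The images of [(0, 0)] and [(1, 0)] recover the scalar and the translation. *)
pose h (s : {perm vert q}) := ((s (1, 0)).1 - (s (0, 0)).1, s (0, 0)).
have hE (s : {perm vert q}) l b : (forall v, s v = (l * v.1 + b.1, l * v.2 + b.2)) ->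
    h s = (l, b).
  move=> sE; rewrite /h !sE /=; congr (_, _); first by ring.
  by case: b {sE} => b1 b2 /=; congr (_, _); ring.
have aff_inj l (b : vert q) : l != 0 ->
    injective (fun v : vert q => (l * v.1 + b.1, l * v.2 + b.2) : vert q).
  move=> l0 [x y] [x' y'] /= /eqP; rewrite xpair_eqE => /andP[].
  by do 2!rewrite (inj_eq (addIr _)) (inj_eq (mulfI l0)) => /eqP ->.
have imh : h @: affine_maps q = setX [set~ 0] setT.
  apply/setP => -[l b]; rewrite !inE andbT; apply/imsetP/idP => [[s]|l_neq0].
    rewrite inE => /existsP[l' /existsP[b' /andP[l_neq0 /forallP sE]]].
    by rewrite (hE s l' b') => [[-> _] //|v]; apply/eqP.
  exists (perm (aff_inj l b l_neq0)).
    rewrite inE; apply/existsP; exists l; apply/existsP; exists b.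
    by rewrite l_neq0; apply/forallP => v; rewrite permE.
  by rewrite (hE _ l b) // => v; rewrite permE.
rewrite -(@card_in_imset _ _ h) => [|s s'].
  by rewrite imh cardsX cardsC1 cardsT card_prod card_Fp // mulnn mulnC subn1.
rewrite !inE.
move=> /existsP[l /existsP[b /andP[_ /forallP sE]]].
move=> /existsP[l' /existsP[b' /andP[_ /forallP sE']]].
rewrite (hE s l b) => [|v]; last exact/eqP.
rewrite (hE s' l' b') => [[ll bb]|v]; last exact/eqP.
by apply/permP => v; rewrite (eqP (sE v)) (eqP (sE' v)) ll bb.
Qed.

Lemma autGS_neq_affine S : (6 < q)%N -> S \in half_subsets q ->
  autGS S != affine_maps q ->
  exists a b c d : 'F_q, [/\ a * d - b * c != 0,
    ~~ [&& b == 0, c == 0 & a == d] & moebius a b c d @: S \subset S].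
Proof.
move=> q_gt6; rewrite inE => /eqP cardS.
rewrite eqEsubset affine_maps_autGS andbT => /subsetPn[s].
rewrite inE => /forallP s_aut s_naff.
have q_odd : odd q by case: (even_prime q_pr) => // q2; rewrite q2 in q_gt6.
have s_hom : {homo s : u v / slope_adj S u v}.
  by move=> u v; have /forallP/(_ v)/eqP := s_aut u; rewrite /slope_adj /GS_adj => ->.
(* From [q >= 7] come the three slopes needed for affinity. *)
have half_gt2 : (2 < q.-1./2)%N by lia.
have [a [b [c [d [e [f [sE det_neq0 stable]]]]]]] :=
  hom_affine q_pr (card_Fp q_pr) (@perm_inj _ s) q_odd half_gt2 cardS s_hom.
exists a, b, c, d; split=> //.
apply: contra s_naff => /and3P[/eqP b0 /eqP c0 /eqP ad].
rewrite inE; apply/existsP; exists a; apply/existsP; exists (e, f).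
rewrite b0 ad mul0r subr0 mulf_eq0 orbb in det_neq0; rewrite ad det_neq0.
by apply/forallP => v; rewrite sE b0 c0 ad !mul0r addr0 add0r.
Qed.

Lemma card_half_subsets : #|half_subsets q| = 'C(q, q.-1./2).
Proof. by rewrite /half_subsets card_draws card_Fp. Qed.

Lemma card_exceptional_sets : (6 < q)%N ->
  (#|[set S in half_subsets q | autGS S != affine_maps q]|
    <= q ^ 4 * 2 ^ (q + 3)./2)%N.
Proof.
move=> q_gt6.
pose ok (t : 'F_q * 'F_q * ('F_q * 'F_q)) :=
  (t.1.1 * t.2.2 - t.1.2 * t.2.1 != 0)
  && ~~ [&& t.1.2 == 0, t.2.1 == 0 & t.1.1 == t.2.2].
pose A (t : 'F_q * 'F_q * ('F_q * 'F_q)) :=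
  [set S : {set 'F_q} | moebius t.1.1 t.1.2 t.2.1 t.2.2 @: S \subset S].
have sub : [set S in half_subsets q | autGS S != affine_maps q]
    \subset \bigcup_(t | ok t) A t.
  apply/subsetP => S; rewrite inE => /andP[halfS nS].
  have [a [b [c [d [det_neq0 nonscalar stable]]]]] := autGS_neq_affine q_gt6 halfS nS.
  apply/bigcupP; exists ((a, b), (c, d)); last by rewrite inE.
  by rewrite /ok /= det_neq0.
rewrite (leq_trans (subset_leq_card sub)) //.
have -> : (q ^ 4 = #|{: 'F_q * 'F_q * ('F_q * 'F_q)}|)%N.
  by rewrite !card_prod !card_Fp // mulnn mulnn -expnM.
apply: leq_card_bigcup => t /andP[det_neq0 nonscalar].
have := card_moebius_stable det_neq0 nonscalar.
by rewrite card_Fp.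
Qed.

Lemma card_exceptional_sets_small (M : nat) : (65 + 1296 * M <= q)%N ->
  (M * #|[set S in half_subsets q | autGS S != affine_maps q]|
    <= #|half_subsets q|)%N.
Proof.
move=> q_ge; have q_gt6 : (6 < q)%N by lia.
have q_odd : odd q by case: (even_prime q_pr) => // q2; rewrite q2 in q_gt6.
pose k := q.-1./2; have qE : q = k.*2.+1 by rewrite /k; lia.
rewrite (leq_trans (leq_mul (leqnn _) (card_exceptional_sets q_gt6))) //.
rewrite card_half_subsets -/k.
have -> : ((q + 3)./2 = k.+2)%N by lia.
(* The threshold on [q] amounts to [k >= 32 + 648 M]. *)
by rewrite qE; apply: union_bound_le_central_bin; lia.
Qed.

(** Serves both limits: sets violating [P] are exceptional, hence at most a fraction [1 / M <= eps]
    of all. *)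
Lemma prob_half_ge (eps : rat) (M : nat) (P : {set 'F_q} -> bool) :
  0 < eps -> eps^-1 <= M%:R -> (65 + 1296 * M <= q)%N ->
  (forall S, autGS S == affine_maps q -> P S) ->
  1 - eps <= prob_half P.
Proof.
move=> eps_gt0 leM q_ge affP; rewrite /prob_half.
have half_gt0 : (0 < #|half_subsets q|)%N.
  by rewrite card_half_subsets bin_gt0; lia.
rewrite ler_pdivlMr ?ltr0n // mulrBl mul1r lerBlDr.
set bad := [set S in half_subsets q | autGS S != affine_maps q].
have half_le : (#|half_subsets q| <= #|[set S in half_subsets q | P S]| + #|bad|)%N.
  rewrite (leq_trans _ (leq_card_setU _ _)) //; apply/subset_leq_card/subsetP => S.
  by rewrite !inE => ->; case: eqP => [/eqP/affP->|]; rewrite ?orbT.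
have bad_le : #|bad|%:R <= eps * #|half_subsets q|%:R.
  rewrite -ler_pdivrMl //; apply: (@le_trans _ _ (M%:R * #|bad|%:R)).
    by rewrite ler_wpM2r ?ler0n.
  by rewrite -natrM ler_nat card_exceptional_sets_small.
apply: (@le_trans _ _ (#|[set S in half_subsets q | P S]|%:R + #|bad|%:R)).
  by rewrite -natrD ler_nat.
by rewrite lerD2l.
Qed.
End GS.

(* Probabilities tend to 1 as q -> infinity through primes q >= 3. *)
Theorem mainTheorem10 :
  (forall eps : rat, 0 < eps -> exists N : nat, forall q : nat,
     prime q -> (3 <= q)%N -> (N <= q)%N ->
     1 - eps <= prob_half (fun S : {set 'F_q} => autGS S == affine_maps q))
  /\
  (forall eps : rat, 0 < eps -> exists N : nat, forall q : nat,
     prime q -> (3 <= q)%N -> (N <= q)%N ->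
     1 - eps <= prob_half (fun S : {set 'F_q} => #|autGS S| == (q ^ 2 * (q - 1))%N)).
Proof.
split=> eps eps_gt0; exists (65 + 1296 * Num.bound eps^-1)%N => q q_pr _ q_ge;
  apply: (prob_half_ge q_pr eps_gt0 _ q_ge);
  rewrite ?ltW ?archi_boundP ?invr_ge0 ?ltW // => S /eqP ->.
by rewrite card_affine_maps.
Qed.
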